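(* Let $q$ be a transcendental complex number. Let $v,w$ be positive integers and let $(r_i,s_i)_{1\le i\le v}$, $(t_j,u_j)_{1\le j\le w}$ be pairs of integers with $s_i>0$ for all $i$ and $u_j\neq 0$ for all $j$, such that $\alpha_i:=r_i/s_i\notin\mathbb Z_{\leq 0}$ and $\beta_j:=t_j/u_j\notin\mathbb Z_{\le 0}$ for all $i,j$. Let $$Q_{\mathbf r,\mathbf t}(q;n):=\frac{(q^{r_1};q^{s_1})_n\cdots(q^{r_v};q^{s_v})_n}{(q^{t_1};q^{u_1})_n\cdots(q^{t_w};q^{u_w})_n},\quad n\geq 0.$$ Then the following are equivalent: (i) the sequence $(Q_{\mathbf r,\mathbf t}(q;n))_{n\geq0}$ is $q$-integral; (ii) for every $b\in\{1,\dots,d_{\mathbf r,\mathbf t}\}$ and every $x\in\mathbb R$, $\Xi_{\mathbf r,\mathbf t}(b,x)\geq 0$.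
   Context: $(q^r;q^s)_n:=\prod_{i=0}^{n-1}(1-q^{r+si})$ for $n\ge 0$. A sequence $(R(q;n))_{n\ge0}$ in $\mathbb Q(q)$ with $R(q;0)=1$ is $q$-integral if there is $C(q)\in\mathbb Z[q]\setminus\{0\}$ with $C(q)^nR(q;n)\in\mathbb Z[q]$ for all $n\ge0$. For real $x$, $\langle x\rangle$ is the fractional part of $x$ if $x\notin\mathbb Z$ and $1$ if $x\in\mathbb Z$. Christol order on $\mathbb R$: $x\preceq y$ iff $\langle x\rangle<\langle y\rangle$, or $\langle x\rangle=\langle y\rangle$ and $x\ge y$. Let $d_{\mathbf r,\mathbf t}$ be the (positive) least common multiple of $s_1,\dots,s_v,u_1,\dots,u_w$. For $b\in\{1,\dots,d_{\mathbf r,\mathbf t}\}$: set $c_i:=\gcd(r_i,s_i,b)$, $d_j:=\gcd(t_j,u_j,b)$, $V_b:=\{i:\gcd(s_i,b)=c_i\}$, $W_b:=\{j:\gcd(u_j,b)=d_j\}$; for $i\in V_b$, $j\in W_b$ choose positive integers $e_i,f_j$ with $be_i\equiv c_i \pmod{s_i}$ and $bf_j\equiv d_j\pmod{u_j}$; let $\tilde b$ be the greatest divisor of $b$ coprime to $d_{\mathbf r,\mathbf t}$ and $a\in\{1,\dots,d_{\mathbf r,\mathbf t}\}$ with $a\tilde b\equiv1\pmod{d_{\mathbf r,\mathbf t}}$. Then $$\Xi_{\mathbf r,\mathbf t}(b,x):=\#\Big\{(i,k)\in V_b\times\{0,\dots,c_i-1\}:\tfrac{\langle e_i\alpha_i\rangle+k}{c_i}-\lfloor1-a\alpha_i\rfloor\preceq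 x\Big\}-\#\Big\{(j,\ell)\in W_b\times\{0,\dots,d_j-1\}:\tfrac{\langle f_j\beta_j\rangle+\ell}{d_j}-\lfloor1-a\beta_j\rfloor\preceq x\Big\}$$ (this does not depend on the choice of $e_i,f_j$). *)

(* Defs.v *)
From HB Require Import structures.
From mathcomp Require Import all_boot all_order all_algebra.
From mathcomp Require Import reals complex.

Set Implicit Arguments.
Unset Strict Implicit.
Unset Printing Implicit Defensive.

Import Order.TTheory GRing.Theory Num.Theory.

Local Open Scope ring_scope.

Section QSequences.
Variable K : fieldType.
Implicit Types (q z : K) (R : nat -> K).

Definition qpoch q (r s : int) (n : nat) : K :=
  \prod_(i < n) (1 - q ^ (r + s * i%:Z)).

Definition Qrt q (v w : nat) (r s : 'I_v -> int) (t u : 'I_w -> int)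
    (n : nat) : K :=
  (\prod_(i < v) qpoch q (r i) (s i) n) / (\prod_(j < w) qpoch q (t j) (u j) n).

Definition zeval q (P : {poly int}) : K := (map_poly intr P).[q].

(* The subring Z[q] and the subfield Q(q) of K; every element of Q(q) is a
   quotient of two elements of Z[q], after clearing denominators. *)
Definition in_Zq q z : Prop := exists P : {poly int}, z = zeval q P.

Definition in_Qq q z : Prop :=
  exists P1 P2 : {poly int}, zeval q P2 != 0 /\ z = zeval q P1 / zeval q P2.

Definition q_integral q R : Prop :=
  [/\ R 0%N = 1,
      forall n, in_Qq q (R n)
    & exists C : K, [/\ in_Zq q C, C != 0
                      & forall n, in_Zq q (C ^+ n * R n)]].

End QSequences.

Section Christol.
Variable R : realType.
Implicit Types x y : R.

Definition frac1 x : R :=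
  if x \is a Num.int then 1 else x - (Num.floor x)%:~R.

(* Ties go the other way: [x] precedes [y] when they have the same fractional
   part and [x >= y]. *)
Definition preceq x y : bool :=
  (frac1 x < frac1 y) || ((frac1 x == frac1 y) && (y <= x)).

Definition qratio (r s : int) : R := r%:~R / s%:~R.

Definition nonpos_int x : bool := (x \is a Num.int) && (x <= 0).

End Christol.

Section Xi.
Local Open Scope nat_scope.

Definition drt (v w : nat) (s : 'I_v -> int) (u : 'I_w -> int) : nat :=
  lcmn (\big[lcmn/1]_(i < v) `|s i|) (\big[lcmn/1]_(j < w) `|u j|).

Definition btilde (d b : nat) : nat :=
  \max_(m <- divisors b | coprime m d) m.

(* The unique a in {1, ..., d} with a * btilde d b = 1 mod d, see [ainvP]. *)
Definition ainv (d b : nat) : nat :=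
  head 0 [seq a <- iota 1 d | a * btilde d b == 1 %[mod d]].

Definition cgcd (r s : int) (b : nat) : nat := gcdn (gcdn `|r| `|s|) b.

Definition in_V (r s : int) (b : nat) : bool := gcdn `|s| b == cgcd r s b.

(* [e b i] is an admissible choice of the integer e_i attached to b.  For the
   family (t, u) it is an admissible choice of the f_j. *)
Definition valid_choice (v : nat) (r s : 'I_v -> int) (d : nat)
    (e : nat -> 'I_v -> nat) : Prop :=
  forall (b : nat) (i : 'I_v), 1 <= b <= d -> in_V (r i) (s i) b ->
    0 < e b i /\ b * e b i = cgcd (r i) (s i) b %[mod `|s i|].

(* Number of pairs (i, k) contributed to Xi by one of the two families. *)
Definition Xi_count (R : realType) (v : nat) (r s : 'I_v -> int)
    (e : 'I_v -> nat) (a b : nat) (x : R) : nat :=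
  #|[set p : {i : 'I_v & 'I_(cgcd (r i) (s i) b)} |
      let i := tag p in
      let k : nat := tagged p in
      let alpha : R := qratio R (r i) (s i) in
      let c := cgcd (r i) (s i) b in
      in_V (r i) (s i) b &&
      preceq ((frac1 ((e i)%:R * alpha) + k%:R) / c%:R
              - (Num.floor (1 - a%:R * alpha))%:~R)%R x]|.

Definition Xi (R : realType) (v w : nat) (r s : 'I_v -> int)
    (t u : 'I_w -> int) (e : 'I_v -> nat) (f : 'I_w -> nat)
    (b : nat) (x : R) : int :=
  let a := ainv (drt s u) b in
  ((Xi_count r s e a b x)%:Z - (Xi_count t u f a b x)%:Z)%R.

Lemma btilde_gt0 (d b : nat) : 0 < btilde d b.
Proof.
apply: (@leq_bigmax_seq _ (divisors b) (fun m => coprime m d) (fun m => m) 1).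
  exact: divisor1.
exact: coprime1n.
Qed.

Lemma btilde_coprime (d b : nat) : coprime (btilde d b) d.
Proof.
pose P m := (m == 0) || coprime m d.
suff : P (btilde d b) by rewrite /P -[_ == 0]negbK -lt0n btilde_gt0.
rewrite /btilde; apply: (big_ind P) => [|m n Pm Pn|m cm]; rewrite /P ?cm ?orbT //.
by rewrite /maxn; case: ifP.
Qed.

Lemma ainvP (d b : nat) : 0 < d ->
  1 <= ainv d b <= d /\ ainv d b * btilde d b = 1 %[mod d].
Proof.
move=> d_gt0.
set p := fun a => a * btilde d b == 1 %[mod d].
have : ainv d b \in [seq a <- iota 1 d | p a].
  rewrite /ainv -/p; have : has p (iota 1 d).
    have [k _ /dvdnP[m mE]] := Bezoutl d (btilde_gt0 d b).
    move: mE; rewrite (eqP (btilde_coprime d b)) => mE.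
    have pm : m * btilde d b = 1 + k * d by rewrite -mE.
    pose a := if m %% d == 0 then d else m %% d.
    have am : a = m %[mod d].
      by rewrite /a; case: eqP => [->|_]; rewrite ?modnn ?modn_mod.
    apply/hasP; exists a; last by rewrite /p -modnMml am modnMml pm addnC modnMDl.
    rewrite mem_iota add1n ltnS /a; have := ltn_pmod m d_gt0.
    by case: eqP => [_|/eqP]; rewrite ?d_gt0 ?leqnn // -lt0n => -> /ltnW.
  by rewrite has_filter; case: filter => // y l _; rewrite mem_head.
by rewrite mem_filter mem_iota add1n ltnS => /andP[/eqP -> ->].
Qed.

Lemma valid_choice_exists (v : nat) (r s : 'I_v -> int) (d : nat) :
  exists e, valid_choice r s d e.
Proof.
exists (fun b i => (egcdn b `|s i|).1) => b i /andP[b_gt0 _] /eqP <-.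
case: egcdnP => // m n mE _ /=; rewrite gcdnC in mE.
split; last by rewrite mulnC mE modnMDl.
rewrite lt0n; apply/eqP => m0; move: mE; rewrite m0 mul0n => /esym/eqP.
by rewrite eqn0Ngt addn_gt0 gcdn_gt0 b_gt0 !orbT.
Qed.

End Xi.

(* Main.v *)
Require Import Defs.
From mathcomp Require Import all_boot all_order all_algebra.
From mathcomp Require Import all_field boolp reals complex.
From mathcomp Require Import zify ring lra.
Import Order.TTheory GRing.Theory Num.Theory.
Local Open Scope ring_scope.

(* Up to sign and a power of q, 1 - q^m is the product of the cyclotomic
   polynomials Phi_b(q) for b dividing m.  Hence Q(q;n) is q-integral if and
   only if, for all large b and all n, at least as many numerator factors as
   denominator factors among the first n have exponent divisible by b: each of
   the finitely many small b contributes at most w n negative valuations, which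
   C(q)^n can absorb.
   For b large, the k < b with b | r + s k are the numbers b theta - alpha,
   where theta = (<e alpha> + m) / c runs over the rationals entering Xi.
   Comparing such positions amounts to comparing theta first, and then alpha in
   reverse order, which is exactly the Christol order of the shifted values, and
   which depends only on b modulo d.  So the partial sums over n of the
   valuations are the values of Xi. *)

(** * Cyclotomic valuations *)

(** When no exponent vanishes, this is the multiplicity of ['Phi_b] in the product of the factors 1
    - q^(r + s k), k < n. The absolute value allows negative exponents. *)
Definition hits (b : nat) (r s : int) (n : nat) : nat :=
  (\sum_(k < n) (b %| `|(r + s * k%:Z)%R|))%N.

(** Numerator of 1 - X^m as a polynomial: for m < 0 one has 1 - X^m = (X^|m| - 1) / X^|m|, and
    [negpart] records the exponent of that denominator. *)
Definition lfac (m : int) : {poly int} :=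
  if m is Posz k then 1 - 'X^k else 'X^(`|m|%N) - 1.

Definition negpart (m : int) : nat := if m is Negz k then k.+1 else 0%N.

Definition lprod (v : nat) (r s : 'I_v -> int) (n : nat) : {poly int} :=
  \prod_(i < v) \prod_(k < n) lfac (r i + s i * k%:Z).

Definition negprod (v : nat) (r s : 'I_v -> int) (n : nat) : nat :=
  (\sum_(i < v) \sum_(k < n) negpart (r i + s i * k%:Z)%R)%N.

(** * Passing between the field and integer polynomials *)

Section Evaluation.
Variables (K : fieldType) (q : K).
Hypothesis zeval_eq0 : forall P : {poly int}, zeval q P = 0 -> P = 0.

Let ev : {rmorphism {poly int} -> K} :=
  horner_eval q \o map_poly (intr : int -> K).

Lemma zevalE P : zeval q P = ev P. Proof. by []. Qed.

Lemma zevalX : zeval q 'X = q.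
Proof. by rewrite /zeval map_polyX hornerX. Qed.

Lemma transc_neq0 : q != 0.
Proof.
apply/eqP => q0; have /zeval_eq0/eqP : zeval q 'X = 0 by rewrite zevalX.
by rewrite polyX_eq0.
Qed.

Lemma zeval_inj P1 P2 : zeval q P1 = zeval q P2 -> P1 = P2.
Proof.
move=> E; apply/eqP; rewrite -subr_eq0; apply/eqP/zeval_eq0.
by rewrite zevalE rmorphB -!zevalE E subrr.
Qed.

Lemma zeval_neq0 P : P != 0 -> zeval q P != 0.
Proof. by apply: contraNneq => /zeval_eq0 ->. Qed.

Lemma lfacE (m : int) : 1 - q ^ m = zeval q (lfac m) / q ^+ negpart m.
Proof.
have qn0 n : q ^+ n != 0 by rewrite expf_neq0 ?transc_neq0.
case: m => n /=.
  by rewrite zevalE rmorphB rmorph1 rmorphXn -!zevalE zevalX expr0 divr1.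
rewrite zevalE rmorphB rmorph1 rmorphXn -!zevalE zevalX.
by rewrite mulrBl divff // mul1r.
Qed.

Lemma prod_lprodE (v : nat) (r s : 'I_v -> int) n :
  \prod_(i < v) qpoch q (r i) (s i) n =
  zeval q (lprod v r s n) / q ^+ negprod v r s n.
Proof.
rewrite /lprod /negprod zevalE rmorph_prod expr_sum -prodf_div.
apply: eq_bigr => i _; rewrite rmorph_prod expr_sum -prodf_div.
by apply: eq_bigr => k _; rewrite lfacE.
Qed.
End Evaluation.

Lemma lfac_neq0 (m : int) : m != 0 -> lfac m != 0.
Proof.
case: m => [[//|n] _|n _] /=.
  by rewrite -opprB oppr_eq0 monic_neq0 ?(monicXnsubC 1).
by rewrite monic_neq0 ?(monicXnsubC 1).
Qed.

Lemma lprod_neq0 (v : nat) (r s : 'I_v -> int) n :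
  (forall i k, r i + s i * Posz k != 0) -> lprod v r s n != 0.
Proof.
by move=> h; apply/prodf_neq0 => i _; apply/prodf_neq0 => k _; apply: lfac_neq0.
Qed.

Lemma lfac_sgn (m : int) : exists b : bool,
  lfac m = (-1) ^+ b * ('X^(`|m|%N) - 1).
Proof.
case: m => n; last by exists false; rewrite mul1r.
by exists true; rewrite expr1 mulN1r opprB.
Qed.

(** The range does not depend on [m], so that the factorizations of many factors can be multiplied
    index by index. *)
Lemma prod_Cyclotomic_upto (m M : nat) : (0 < m <= M)%N ->
  'X^m - 1 = \prod_(1 <= b < M.+1) 'Phi_b ^+ (b %| m)%N.
Proof.
move=> /andP[m0 mM]; rewrite -prod_Cyclotomic //.
rewrite [RHS](eq_bigr (fun b => if (b %| m)%N then 'Phi_b else 1)); last first.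
  by move=> b _; case: ifP.
rewrite -big_mkcond -[RHS]big_filter; apply: perm_big; apply: uniq_perm.
- exact: divisors_uniq.
- by rewrite filter_uniq // iota_uniq.
move=> b; rewrite mem_filter -dvdn_divisors // mem_index_iota ltnS.
case: (boolP (b %| m)%N) => //= bm.
by rewrite (dvdn_gt0 m0 bm) (leq_trans (dvdn_leq m0 bm)).
Qed.

Lemma lprod_Cyclotomic (v : nat) (r s : 'I_v -> int) (n M : nat) :
  (forall i (k : 'I_n), (0 < `|(r i + s i * Posz k)%R| <= M)%N) ->
  exists b : bool, lprod v r s n = (-1) ^+ b *
    \prod_(1 <= b < M.+1) 'Phi_b ^+ (\sum_(i < v) hits b (r i) (s i) n)%N.
Proof.
move=> h.
have sgnM (e1 e2 : bool) :
    (-1) ^+ e1 * (-1) ^+ e2 = (-1) ^+ (e1 (+) e2) :> {poly int}.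
  by rewrite -signr_addb.
have sgnP (I : finType) (F G : I -> {poly int}) :
    (forall i, exists b : bool, F i = (-1) ^+ b * G i) ->
  exists b : bool, \prod_i F i = (-1) ^+ b * \prod_i G i.
  move=> hF; elim/big_rec2: _ => [|i x y _ [e ->]]; first by exists false; rewrite mulr1.
  by have [e' ->] := hF i; exists (e' (+) e); rewrite -sgnM; ring.
have [e ->] : exists b : bool, lprod v r s n = (-1) ^+ b *
    \prod_(i < v) \prod_(k < n) \prod_(1 <= b < M.+1)
        'Phi_b ^+ (b %| `|(r i + s i * Posz k)%R|)%N.
  apply: (sgnP) => i; apply: (sgnP) => k.
  have [e ->] := lfac_sgn (r i + s i * Posz k); exists e.
  by rewrite (prod_Cyclotomic_upto _ _ (h i k)).
exists e; congr (_ * _).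
transitivity (\prod_(i < v) \prod_(1 <= b < M.+1) 'Phi_b ^+ hits b (r i) (s i) n).
  apply: eq_bigr => i _; rewrite exchange_big /=; apply: eq_bigr => b _.
  by rewrite /hits expr_sum.
by rewrite exchange_big /=; apply: eq_bigr => b _; rewrite expr_sum.
Qed.

(** As s > 0, each exponent is at least r, so each factor needs at most |r| powers of q. The bound
    is linear in [n], hence absorbed by the n-th power of a fixed monomial. *)
Lemma negprod_le (v : nat) (r s : 'I_v -> int) n : (forall i, 0 < s i) ->
  (negprod v r s n <= (\sum_(i < v) `|r i|) * n)%N.
Proof.
move=> hs; rewrite /negprod big_distrl /=; apply: leq_sum => i _.
have -> : (`|r i| * n = \sum_(k < n) `|r i|)%N by rewrite sum_nat_const card_ord mulnC.
apply: leq_sum => k _.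
have: 0 <= s i * k%:Z by rewrite mulr_ge0 // ltW.
rewrite /negpart; case E: (r i + s i * k%:Z) => [//|m]; lia.
Qed.

Lemma hits_le (b : nat) (r s : int) n : (hits b r s n <= n)%N.
Proof.
rewrite -[leqRHS]muln1 -[X in (X * 1)%N]card_ord -sum_nat_const.
by apply: leq_sum => k _; exact: leq_b1.
Qed.

(** X^m - 1 is separable in characteristic 0, so its roots are simple. *)
Lemma mup_Xn_sub_1 (b m : nat) (z : algC) : b.-primitive_root z -> (0 < m)%N ->
  mup z ('X^m - 1) = (b %| m)%N.
Proof.
move=> zb m0; have p0 : 'X^m - 1 != 0 :> {poly algC}.
  by rewrite monic_neq0 ?(monicXnsubC 1).
have rootE' : root ('X^m - 1) z = (b %| m)%N.
  by rewrite (prim_order_dvd zb) rootE !hornerE subr_eq0.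
case: (boolP (b %| m)%N) => bm; last by rewrite mupNroot // rootE'.
apply/eqP; rewrite eqn_leq mup_leq // mup_geq // expr1 dvdp_XsubCl rootE' bm andbT.
rewrite (@separable_nosquare _ ('X^m - 1)) ?size_XsubC //.
by apply: separable_Xn_sub_1; rewrite pnatr_eq0 -lt0n.
Qed.

Definition poly_algC (P : {poly int}) : {poly algC} := map_poly intr P.

Lemma poly_algC_eq0 P : (poly_algC P == 0) = (P == 0).
Proof.
rewrite /poly_algC; have [->|P0] := eqVneq P 0; first by rewrite rmorph0 eqxx.
by rewrite map_poly_eq0_id0 ?intr_eq0 ?lead_coef_eq0 // (negPf P0).
Qed.

Lemma mup_prod (F : fieldType) (z : F) (I : finType) (G : I -> {poly F}) :
  (forall i, G i != 0) -> mup z (\prod_i G i) = (\sum_i mup z (G i))%N.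
Proof.
move=> h; pose Q (p : {poly F}) n := (p != 0) && (mup z p == n).
suff : Q (\prod_i G i) (\sum_i mup z (G i))%N by case/andP => _ /eqP.
apply: (big_ind2 Q) => [|p1 n1 p2 n2 /andP[p10 /eqP <-] /andP[p20 /eqP <-]|i _].
- by rewrite /Q oner_neq0 mupNroot ?root1.
- by rewrite /Q mulf_neq0 // mupM // eqxx.
- by rewrite /Q h eqxx.
Qed.

(** The multiplicity at a primitive b-th root of unity serves as the valuation at ['Phi_b]. *)
Lemma mup_lprod (b : nat) (z : algC) (v : nat) (r s : 'I_v -> int) n :
  b.-primitive_root z -> (forall i k, r i + s i * Posz k != 0) ->
  mup z (poly_algC (lprod v r s n)) = (\sum_(i < v) hits b (r i) (s i) n)%N.
Proof.
move=> zb h.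
have hl i k : poly_algC (lfac (r i + s i * Posz k)) != 0.
  by rewrite poly_algC_eq0 lfac_neq0.
rewrite /poly_algC rmorph_prod mup_prod => [|i]; last first.
  by rewrite rmorph_prod; apply/prodf_neq0 => k _; apply: hl.
apply: eq_bigr => i _; rewrite rmorph_prod mup_prod => [|k]; last exact: hl.
apply: eq_bigr => k _.
have [e ->] := lfac_sgn (r i + s i * Posz k).
rewrite rmorphM rmorphXn rmorphN rmorph1 rmorphB rmorphXn rmorph1 /= map_polyX.
rewrite mupMr ?(mup_Xn_sub_1 b) // ?absz_gt0 //.
by case: e; rewrite ?expr1 ?expr0 ?rootN root1.
Qed.

(** A number is a primitive root of unity of at most one order, so a finite list rules out only
    finitely many orders. *)
Lemma prim_root_eventually_notin (rs : seq algC) : exists B : nat,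
  forall b z, (B <= b)%N -> b.-primitive_root z -> z \notin rs.
Proof.
elim: rs => [|a rs [B hB]]; first by exists 0%N.
have [[b0 hb0]|no] := pselect (exists b0 : nat, b0.-primitive_root a).
  exists (maxn B b0.+1) => b z; rewrite geq_max => /andP[Bb bb] zb.
  rewrite inE negb_or (hB b) // andbT; apply: contraTneq bb => za.
  move: zb; rewrite za => ab; rewrite -leqNgt.
  have -> // : b = b0.
  by apply/eqP; rewrite eqn_dvd (prim_order_dvd ab) (prim_order_dvd hb0)
    !prim_expr_order ?eqxx.
exists B => b z Bb zb; rewrite inE negb_or (hB b) // andbT.
by apply/eqP => za; apply: no; exists b; rewrite -za.
Qed.

(** * Integrality as an inequality between hit counts *)

Section Integrality.
Variables (K : fieldType) (q : K).
Hypothesis zeval_eq0 : forall P : {poly int}, zeval q P = 0 -> P = 0.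
Variables (v w : nat) (r s : 'I_v -> int) (t u : 'I_w -> int).
Hypothesis s_gt0 : forall i, 0 < s i.
Hypothesis num_neq0 : forall i k, r i + s i * Posz k != 0.
Hypothesis den_neq0 : forall j k, t j + u j * Posz k != 0.

(** Clearing denominators and powers of q gives an identity between values at q, which transcendence
    lifts to an identity of polynomials. *)
Lemma Qrt_clear (P S : {poly int}) n :
  zeval q P ^+ n * Qrt q r s t u n = zeval q S <->
  P ^+ n * lprod v r s n * 'X^(negprod w t u n) =
  S * lprod w t u n * 'X^(negprod v r s n).
Proof.
rewrite /Qrt !(prod_lprodE _ _ zeval_eq0).
have q0 := transc_neq0 _ _ zeval_eq0.
have q_n m : q ^+ m != 0 by rewrite expf_neq0.
have D0 : zeval q (lprod w t u n) != 0 by apply: zeval_neq0 => //; exact: lprod_neq0.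
set A := zeval q (lprod v r s n); set B := zeval q (lprod w t u n).
set x := q ^+ _; set y := q ^+ _.
have -> : A / x / (B / y) = (A * y) / (B * x) by field; rewrite !q_n D0.
have evE : zeval q (P ^+ n * lprod v r s n * 'X^(negprod w t u n)) =
    zeval q P ^+ n * (A * y).
  by rewrite zevalE !rmorphM !rmorphXn -!zevalE zevalX mulrA.
have evE' : zeval q (S * lprod w t u n * 'X^(negprod v r s n)) =
    zeval q S * (B * x).
  by rewrite zevalE !rmorphM !rmorphXn -!zevalE zevalX mulrA.
have BX0 : B * x != 0 by rewrite mulf_neq0 // q_n.
split=> [E|E].
  by apply: (zeval_inj _ _ zeval_eq0); rewrite evE evE' -E -[RHS]mulrA divfK.
by apply: (mulIf BX0); rewrite /= -[LHS]mulrA divfK // -evE -evE' E.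
Qed.

(** At a primitive b-th root of unity where the multiplier [P] does not vanish, [P ^+ n] and the
    powers of ['X] have multiplicity 0, while that of [S] is nonnegative; this holds for all large
    b. *)
Lemma hits_le_of_q_integral : q_integral q (Qrt q r s t u) ->
  exists B, forall b n, (B <= b)%N ->
   (\sum_(j < w) hits b (t j) (u j) n <= \sum_(i < v) hits b (r i) (s i) n)%N.
Proof.
case=> _ _ [_ [[P ->] P0 hP]].
have {P0} P0 : P != 0.
  by apply: contraNneq P0 => ->; rewrite zevalE rmorph0.
have [rs rsE] := closed_field_poly_normal (poly_algC P).
have [B hB] := prim_root_eventually_notin rs.
(* [B.+1] rather than [B] makes [b] positive, so that a primitive root exists. *)
exists B.+1 => b n Bb; have [S hS] := hP n.
have /Qrt_clear E := hS.
have [z zb] : {z : algC | b.-primitive_root z}.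
  by apply: C_prim_root_exists; apply: leq_trans Bb.
have S0 : S != 0.
  have: P ^+ n * lprod v r s n * 'X^(negprod w t u n) != 0.
    by rewrite !mulf_neq0 ?expf_neq0 ?polyX_eq0 // lprod_neq0.
  by apply: contraNneq => S0; rewrite E S0 !mul0r.
have z0 : ~~ root 'X z.
  rewrite rootX; apply/eqP => z0; have /eqP := prim_expr_order zb.
  by rewrite z0 expr0n gtn_eqF ?(leq_trans _ Bb) // eq_sym oner_eq0.
have Pz : ~~ root (poly_algC P) z.
  rewrite rsE rootZ ?lead_coef_eq0 ?poly_algC_eq0 // root_prod_XsubC.
  exact: hB (ltnW Bb) zb.
move/(congr1 (mup z \o poly_algC)): E => /=.
rewrite /poly_algC !rmorphM !rmorphXn /= map_polyX.
have rootXN (p : {poly algC}) m : ~~ root p z -> ~~ root (p ^+ m) z.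
  by rewrite !rootE horner_exp => pz; rewrite expf_neq0.
rewrite mupMl ?rootXN // mupMr ?rootXN // => E.
rewrite -(mup_lprod b z) // -(mup_lprod b z v) // [X in (_ <= X)%N]E.
rewrite mupMl ?rootXN // mupM ?leq_addl // -/(poly_algC _) poly_algC_eq0 //.
exact: lprod_neq0.
Qed.

Lemma q_integral_of_hits_le B : (forall b n, (B <= b)%N ->
   (\sum_(j < w) hits b (t j) (u j) n <= \sum_(i < v) hits b (r i) (s i) n)%N) ->
  q_integral q (Qrt q r s t u).
Proof.
move=> hB.
pose N := (\sum_(i < v) `|r i|)%N.
(* The power of ['X] absorbs the [q ^ (r + s * k)] with [r + s * k < 0], the
   cyclotomic factors absorb the finitely many orders [b < B]. *)
pose P : {poly int} := 'X^N * \prod_(1 <= b < B) 'Phi_b ^+ w.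
have P0 : P != 0.
  rewrite mulf_neq0 ?expf_neq0 ?polyX_eq0 // prodf_seq_neq0.
  by apply/allP => b _; rewrite expf_neq0 // monic_neq0 ?Cyclotomic_monic.
have hS n : exists S, zeval q P ^+ n * Qrt q r s t u n = zeval q S.
  (* [M] bounds every exponent, and [B] as well, so that all cyclotomic products run over one
     range. *)
  pose M := (B + \sum_(i < v) \sum_(k < n) `|(r i + s i * Posz k)%R|
     + \sum_(j < w) \sum_(k < n) `|(t j + u j * Posz k)%R|)%N.
  have [|e1 E1] := lprod_Cyclotomic v r s n M.
    move=> i k; rewrite absz_gt0 num_neq0 /= /M.
    by rewrite (bigD1 i) //= (bigD1 k) //=; lia.
  have [|e2 E2] := lprod_Cyclotomic w t u n M.
    move=> i k; rewrite absz_gt0 den_neq0 /= /M.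
    by rewrite addnC (bigD1 i) //= (bigD1 k) //=; lia.
  (* The exponent left to ['Phi_b] in the quotient. The truncated subtraction is exact: for [b < B]
     the denominator contributes at most [w * n], otherwise [hB] applies. *)
  pose X b := (w * n * (b < B) + \sum_(i < v) hits b (r i) (s i) n -
      \sum_(j < w) hits b (t j) (u j) n)%N.
  pose S : {poly int} := 'X^(N * n - negprod v r s n + negprod w t u n) *
    (-1) ^+ (e1 (+) e2) * \prod_(1 <= b < M.+1) 'Phi_b ^+ X b.
  exists S; apply/Qrt_clear.
  have PE : P ^+ n = 'X^(N * n) * \prod_(1 <= b < M.+1) 'Phi_b ^+ (w * n * (b < B)).
    rewrite exprMn -exprM; congr (_ * _).
    have BM : (B <= M.+1)%N by rewrite /M; lia.
    have [B1|B1] := leqP 1 B.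
      rewrite (big_cat_nat B1 BM) /= [X in _ * X]big1_seq ?mulr1; last first.
        move=> b; rewrite mem_index_iota => /andP[_ /andP[Bb _]].
        by rewrite ltnNge Bb muln0.
      rewrite -prodrXl; apply: eq_big_nat => b /andP[_ bB].
      by rewrite bB muln1 exprM.
    (* Here [B = 0]: the left product is empty and all exponents on the right vanish. *)
    rewrite big_geq ?(ltnW B1) // expr1n big1_seq // => b _.
    by case: B B1 {hB} P P0 M E1 E2 X S BM => [|//] _ *; rewrite ltn0 muln0.
  have XE : (\prod_(1 <= b < M.+1) 'Phi_b ^+ X b) *
       \prod_(1 <= b < M.+1) 'Phi_b ^+ (\sum_(j < w) hits b (t j) (u j) n) =
     (\prod_(1 <= b < M.+1) 'Phi_b ^+ (w * n * (b < B))) *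
     \prod_(1 <= b < M.+1) 'Phi_b ^+ (\sum_(i < v) hits b (r i) (s i) n).
    rewrite -!big_split /=; apply: eq_bigr => b _; rewrite -!exprD; congr (_ ^+ _).
    rewrite /X subnK //; have [bB|Bb] := ltnP b B; last first.
      by rewrite muln0 add0n hB.
    rewrite muln1; apply: leq_trans (leq_addr _ _).
    rewrite -[X in (X * n)%N]card_ord -sum_nat_const; apply: leq_sum => j _.
    exact: hits_le.
  rewrite E1 E2 PE /S; move: XE.
  set A1 := \prod_(1 <= b < M.+1) _; set A2 := \prod_(1 <= b < M.+1) _.
  set A3 := \prod_(1 <= b < M.+1) _; set A4 := \prod_(1 <= b < M.+1) _ => XE.
  have nle := negprod_le v r s n s_gt0.
  rewrite signr_addb exprD.
  have -> : 'X^(N * n) =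
      'X^(N * n - negprod v r s n) * 'X^(negprod v r s n) :> {poly int}.
    by rewrite -exprD subnK.
  have e22 : (-1) ^+ e2 * (-1) ^+ e2 = 1 :> {poly int} by rewrite -expr2 sqrr_sign.
  set x1 := 'X^_; set x2 := 'X^_; set x3 := 'X^_.
  transitivity (x1 * x2 * x3 * (-1) ^+ e1 * (A3 * A4)); first by ring.
  rewrite -XE; set y2 := (-1) ^+ e2 in e22 *; set y1 := (-1) ^+ e1.
  transitivity (x1 * x2 * x3 * y1 * (A1 * A2) * (y2 * y2)); last by ring.
  by rewrite e22 mulr1.
have ev0 : zeval q P != 0 by apply: zeval_neq0.
split.
- rewrite /Qrt /qpoch; under eq_bigr do rewrite big_ord0.
  by under [in X in _ / X]eq_bigr do rewrite big_ord0; rewrite !big1_eq divr1.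
- move=> n; have [S hSn] := hS n; exists S, (P ^+ n).
  have -> : zeval q (P ^+ n) = zeval q P ^+ n by rewrite zevalE rmorphXn.
  by rewrite expf_neq0 // -hSn mulrC mulKf ?expf_neq0.
- exists (zeval q P); split=> //; by exists P.
Qed.
End Integrality.

(** * Positions of the zeros modulo b *)

Section Frac.
Variable R : realType.
Implicit Types x y : R.

Lemma frac1_bounds x : 0 < frac1 x <= 1.
Proof.
rewrite /frac1; case: ifPn => [_|xint]; first by rewrite ltr01 lexx.
have := floor_le x; have := floorD1_gt x; rewrite intrD => h1 h2.
have h3 : x != (Num.floor x)%:~R.
  by apply: contraNneq xint => ->; apply: intr_int.
by move: h3; rewrite neq_lt => /orP[|]; lra.
Qed.

Lemma frac1E x : exists z : int, x = z%:~R + frac1 x.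
Proof.
rewrite /frac1; case: ifPn => [|_]; last by exists (Num.floor x); ring.
by move=> /intrP[m ->]; exists (m - 1); rewrite intrD; ring.
Qed.

Lemma int_eq0_lt1 (z : int) : -1 < z%:~R :> R -> z%:~R < 1 :> R -> z = 0.
Proof.
move=> h1 h2; have : (-1 < z)%R by rewrite -(ltr_int R) .
have : (z < 1)%R by rewrite -(ltr_int R).
lia.
Qed.

(** Two points of (0, 1] that differ by an integer coincide. *)
Lemma frac1_unique y (z : int) : 0 < y <= 1 -> frac1 (y + z%:~R) = y.
Proof.
move=> hy; have hf := frac1_bounds (y + z%:~R).
have [m hm] := frac1E (y + z%:~R).
have : z - m = 0 by apply: int_eq0_lt1; rewrite intrB; lra.
by move=> /(congr1 (intr : int -> R)); rewrite intrB /=; lra.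
Qed.
End Frac.

(** Since c = gcd(S, b) divides r, the condition b | r + S k becomes a congruence modulo g = b / c
    in which S / c is invertible: its solutions form one class. The bound |r| < b places the
    representative g F - alpha in [0, g). *)
Lemma progression_pos (R : realType) (r : int) (S b0 b e : nat) :
  (0 < S)%N -> b = b0 %[mod S] -> (`|r| < b)%N ->
  ~~ nonpos_int (qratio R r S%:Z) -> in_V r S%:Z b0 ->
  (b0 * e = cgcd r S%:Z b0 %[mod S])%N ->
  let c := cgcd r S%:Z b0 in let F := frac1 (e%:R * qratio R r S%:Z) in
  exists k0 : nat, [/\ (k0 < b %/ c)%N, (c %| b)%N,
    k0%:R = (b %/ c)%:R * F - qratio R r S%:Z,
    exists y : int, S%:R / c%:R * F = y%:~R
  & forall k : nat, (b %| `|(r + S%:Z * k%:Z)%R|)%N = (k == k0 %[mod b %/ c])].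
Proof.
move=> S0 bb0 rb alphaN inV ebc c F.
have gSb0 : gcdn S b0 = c by apply/eqP.
have gSb : gcdn S b = c by rewrite -gSb0 -[RHS]gcdn_modr -bb0 gcdn_modr.
have c0 : (0 < c)%N by rewrite -gSb gcdn_gt0 S0.
have cS : (c %| S)%N by rewrite -gSb dvdn_gcdl.
have cb : (c %| b)%N by rewrite -gSb dvdn_gcdr.
have /dvdzP[r' rE] : (c%:Z %| r)%Z.
  by rewrite /dvdz /= /c /cgcd; apply: dvdn_trans (dvdn_gcdl _ _) (dvdn_gcdl _ _).
have [S' SE] := dvdnP cS; have [g bE] := dvdnP cb.
have S'0 : (0 < S')%N by move: S0; rewrite SE; case: (S').
have gE : (b %/ c = g)%N by rewrite bE mulnK.
have cop : coprime g S'.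
  rewrite coprime_sym /coprime -(eqn_pmul2r c0) muln_gcdl -SE -bE gSb.
  by rewrite mul1n.
(* Dividing b e = c (mod S) by c makes [e] an inverse of [g] modulo [S']. *)
have [z2 z2E] : exists z2 : int, g%:Z * e%:Z = 1 + S'%:Z * z2.
  have : (b * e = c %[mod S])%N by rewrite -modnMml bb0 modnMml.
  move=> h; exists ((b * e %/ S)%:Z - (c %/ S)%:Z).
  apply: (@mulIf _ c%:Z); first by rewrite eqz_nat -lt0n.
  have h1' : b%:Z * e%:Z = (b * e %/ S)%:Z * S%:Z + (b * e %% S)%:Z.
    by rewrite -!PoszM -PoszD -divn_eq.
  have h2' : c%:Z = (c %/ S)%:Z * S%:Z + (b * e %% S)%:Z.
    by rewrite h -PoszM -PoszD -divn_eq.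
  have bE' : b%:Z = g%:Z * c%:Z by rewrite -PoszM -bE.
  have SE' : S%:Z = S'%:Z * c%:Z by rewrite -PoszM -SE.
  transitivity (b%:Z * e%:Z); first by rewrite bE'; ring.
  rewrite h1' mulrDl mul1r [X in _ = X + _]h2' SE'; ring.
have cR : c%:R != 0 :> R by rewrite pnatr_eq0 -lt0n.
have S'R : S'%:R != 0 :> R by rewrite pnatr_eq0 -lt0n.
have alphaE : qratio R r S%:Z = r'%:~R / S'%:R.
  by rewrite /qratio rE SE -pmulrn natrM intrM -pmulrn; field; rewrite cR S'R.
have [z zE] := frac1E R (e%:R * qratio R r S%:Z).
have FB := frac1_bounds R (e%:R * qratio R r S%:Z).
rewrite -/F in zE FB.
(* [F] has denominator [S'], and [k1 = (b * y0 - r) / S]. *)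
pose y0 : int := e%:Z * r' - z * S'%:Z.
have y0E : y0%:~R = S'%:R * F.
  have -> : F = e%:R * qratio R r S%:Z - z%:~R by lra.
  by rewrite alphaE /y0 intrB !intrM -!pmulrn; field.
have S'gt0 : 0 < S'%:R :> R by rewrite ltr0n.
have y0_gt0 : 0 < y0.
  by rewrite -(ltr_int R) y0E mulr_gt0 //; lra.
have y0_le : y0 <= S'%:Z.
  by rewrite -(ler_int R) y0E -pmulrn; apply: ler_piMr; [exact: ltW | lra].
(* The exact quotient of [g * y0 - r'] by [S'], obtained from g e = 1 + S' z2. *)
pose k1 : int := z2 * r' - g%:Z * z.
have k1E : S'%:Z * k1 = g%:Z * y0 - r'.
  transitivity ((1 + S'%:Z * z2) * r' - g%:Z * S'%:Z * z - r'); first by rewrite /k1; ring.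
  by rewrite -z2E /y0; ring.
have r'g : (`|r'| < g)%N.
  by move: rb; rewrite rE bE abszM ltn_pmul2r.
(* The boundary case F = 1: alpha is then an integer, hence positive by hypothesis, and g - alpha
   stays below g. *)
have r'pos : y0 = S'%:Z -> 0 < r'.
  move=> yS; have : r' = S'%:Z * (g%:Z - k1) by rewrite mulrBr k1E yS; ring.
  move=> r'E; have : qratio R r S%:Z = (g%:Z - k1)%:~R.
    by rewrite alphaE r'E intrM -pmulrn; field.
  move=> aE; move: alphaN; rewrite /nonpos_int aE intr_int /= lerz0 -ltNge => h.
  by rewrite r'E mulr_gt0.
have k1_ge0 : 0 <= k1.
  rewrite -(pmulr_rge0 k1 (_ : 0 < S'%:Z)) // k1E subr_ge0.
  apply: le_trans (ler_peMr (_ : 0 <= g%:Z) y0_gt0) => //.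
  by clear -r'g; lia.
have k1_lt : k1 < g%:Z.
  rewrite -(ltr_pM2l (_ : 0 < S'%:Z)) // k1E.
  have [yS|yS] := eqVneq y0 S'%:Z.
    by have := r'pos yS; rewrite yS mulrC; clear; lia.
  have : y0 <= S'%:Z - 1 by move/eqP: yS y0_le; clear; lia.
  move=> /(ler_wpM2l (_ : 0 <= g%:Z)) => /(_ isT).
  by rewrite mulrBr [S'%:Z * _]mulrC; move: r'g; clear; lia.
exists `|k1|%N.
have k1abs : (`|k1|%N)%:Z = k1 by move: k1_ge0; clear; lia.
split=> //.
- by rewrite gE; move: k1_lt k1_ge0; clear; lia.
- have -> : (`|k1|%N)%:R = k1%:~R :> R by rewrite -{2}k1abs.
  apply: (mulfI S'R); rewrite gE alphaE.
  have /(congr1 (intr : int -> R)) := k1E; rewrite /= intrB !intrM -!pmulrn y0E => ->.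
  by field.
- exists y0; rewrite y0E SE natrM; congr (_ * _); field.
  by rewrite cR.
move=> k; rewrite gE.
have -> : r + S%:Z * k%:Z = b%:Z * y0 + S%:Z * (k%:Z - k1).
  have -> : b%:Z * y0 = (g%:Z * y0 - r' + r') * c%:Z by rewrite bE PoszM; ring.
  by rewrite -k1E rE SE PoszM; ring.
transitivity (b%:Z %| S%:Z * (k%:Z - k1))%Z.
  transitivity (b%:Z %| b%:Z * y0 + S%:Z * (k%:Z - k1))%Z; first by [].
  by rewrite rpredDl // dvdz_mulr.
have -> : b%:Z = c%:Z * g%:Z by rewrite bE PoszM mulrC.
have -> : S%:Z * (k%:Z - k1) = c%:Z * (S'%:Z * (k%:Z - k1)) by rewrite SE PoszM; ring.
rewrite dvdz_mul2l; last by rewrite eqz_nat -lt0n.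
rewrite Gauss_dvdzr; last by rewrite /coprimez /=; apply/eqP; congr Posz; apply/eqP.
by rewrite -k1abs -eqz_mod_dvd !modz_nat eqz_nat.
Qed.

Lemma qratioNN (R : realType) (r s : int) : qratio R (- r) (- s) = qratio R r s.
Proof. by rewrite /qratio !mulrNz invrN mulrNN. Qed.

(** Changing the signs of both r and s preserves r / s and the divisibilities, which reduces s < 0
    to s > 0. *)
Lemma progression (R : realType) (r s : int) (b0 b e : nat) :
  s != 0 -> b = b0 %[mod `|s|] -> (`|r| < b)%N ->
  ~~ nonpos_int (qratio R r s) -> in_V r s b0 ->
  (b0 * e = cgcd r s b0 %[mod `|s|])%N ->
  let c := cgcd r s b0 in let F := frac1 (e%:R * qratio R r s) in
  exists k0 : nat, [/\ (k0 < b %/ c)%N, (c %| b)%N,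
    k0%:R = (b %/ c)%:R * F - qratio R r s,
    exists y : int, (`|s|%N)%:R / c%:R * F = y%:~R
  & forall k : nat, (b %| `|(r + s * k%:Z)%R|)%N = (k == k0 %[mod b %/ c])].
Proof.
case: s => S s0; first by apply: progression_pos; rewrite lt0n.
have -> : Negz S = - S.+1%:Z by rewrite NegzE.
have cE : cgcd r (- S.+1%:Z) b0 = cgcd (- r) S.+1%:Z b0 by rewrite /cgcd !abszN.
have VE : in_V r (- S.+1%:Z) b0 = in_V (- r) S.+1%:Z b0 by rewrite /in_V cE abszN.
rewrite -(qratioNN R r) opprK cE VE abszN absz_nat -(abszN r) => hb rb al inV he.
have [k0 [h1 h2 h3 h4 h5]] := progression_pos R (- r) S.+1 b0 b e isT hb rb al inV he.
exists k0; split=> // k.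
by rewrite -h5 -[in RHS]abszN opprD opprK mulNr.
Qed.

Lemma qratio_pole (R : realType) (r s : int) (k : nat) : s != 0 ->
  ~~ nonpos_int (qratio R r s) -> r + s * k%:Z != 0.
Proof.
move=> s0; apply: contraNneq => E.
have -> : qratio R r s = (- k%:Z)%:~R.
  have -> : r = - (s * k%:Z) by rewrite -[LHS](addrK (s * k%:Z)) E sub0r.
  by rewrite /qratio !mulrNz intrM; field; rewrite intr_eq0.
by rewrite /nonpos_int intr_int /= lerz0; lia.
Qed.

(** A hit forces gcd(s, b) to divide r. Thus indices outside V_b contribute no zeros. *)
Lemma in_V_of_hit (r s : int) (b k : nat) :
  (b %| `|(r + s * k%:Z)%R|)%N -> in_V r s b.
Proof.
move=> bk; rewrite /in_V /cgcd -gcdnA eq_sym; apply/eqP/gcdn_idPr.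
have h : ((gcdn `|s| b)%:Z %| r + s * k%:Z)%Z by apply: dvdn_trans (dvdn_gcdr _ _) bk.
have h2 : ((gcdn `|s| b)%:Z %| s * k%:Z)%Z.
  by apply: dvdz_mulr; exact: (dvdn_gcdl `|s| b).
by move: h; rewrite rpredDr.
Qed.

Lemma in_V_mod (r s : int) (b b0 : nat) : b = b0 %[mod `|s|] ->
  in_V r s b = in_V r s b0.
Proof.
move=> bb; have E : gcdn `|s| b = gcdn `|s| b0 by rewrite -gcdn_modr bb gcdn_modr.
by rewrite /in_V /cgcd -!gcdnA E.
Qed.

Lemma hits_in_V (r s : int) (b n : nat) : ~~ in_V r s b -> hits b r s n = 0%N.
Proof.
move=> h; rewrite /hits big1 // => k _.
by case: (boolP (b %| _)%N) => // /in_V_of_hit hh; rewrite hh in h.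
Qed.

(** Euclidean division writes each k of the class as k0 + m g; the bound n <= g c gives m < c. *)
Lemma count_progression (g c k0 n : nat) : (k0 < g)%N -> (n <= g * c)%N ->
  (\sum_(m < c) (k0 + m * g < n) = \sum_(k < n) (k == k0 %[mod g]))%N.
Proof.
move=> k0g ngc.
transitivity (\sum_(m < c) \sum_(k < n) (k == k0 + m * g :> nat))%N.
  apply: eq_bigr => m _; case: ltnP => h.
    rewrite (bigD1 (Ordinal h)) //= eqxx big1 // => k; rewrite -val_eqE /=.
    by move=> /negPf ->.
  rewrite big1 // => k _; case: eqP => // E; have := ltn_ord k; lia.
rewrite exchange_big; apply: eq_bigr => k _.
have g0 : (0 < g)%N by apply: leq_ltn_trans k0g.
have kc : (k %/ g < c)%N by rewrite ltn_divLR // mulnC (leq_trans (ltn_ord k)).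
rewrite (bigD1 (Ordinal kc)) //= big1 ?addn0 => [|m].
  rewrite {1}(divn_eq k g) addnC eqn_add2r.
  by rewrite [in RHS](modn_small k0g).
rewrite -val_eqE /= => mk; case: eqP => // E.
by move: mk; rewrite E addnC divnMDl // (divn_small k0g) addn0 eqxx.
Qed.

Lemma hits_period (r s : int) (b n : nat) :
  hits b r s (n + b) = (hits b r s n + hits b r s b)%N.
Proof.
rewrite addnC [RHS]addnC /hits big_split_ord /=; congr addn.
apply: eq_bigr => k _; congr nat_of_bool.
rewrite -[LHS]/(b%:Z %| r + s * (b + k)%:Z)%Z -[RHS]/(b%:Z %| r + s * k%:Z)%Z.
have -> : r + s * (b + k)%:Z = b%:Z * s + (r + s * k%:Z) by rewrite PoszD; ring.
by rewrite rpredDl // dvdz_mulr.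
Qed.

(** * Comparison of positions with the Christol order *)

Section Order.
Variable R : realType.

(** Both |s| th and |s'| th' are integers, so distinct values differ by at least 1 / |s s'|; for
    large b, b times this gap outweighs |r/s| + |r'/s'|. *)
Lemma theta_gap (b : nat) (r s r' s' : int) (th th' : R) (p p' : nat) :
  s != 0 -> s' != 0 ->
  (exists y : int, (`|s|%N)%:R * th = y%:~R) ->
  (exists y : int, (`|s'|%N)%:R * th' = y%:~R) ->
  p%:R = b%:R * th - qratio R r s -> p'%:R = b%:R * th' - qratio R r' s' ->
  (`|r| * `|s'| + `|r'| * `|s| < b)%N ->
  th < th' -> (p < p')%N.
Proof.
move=> s0 s'0 [y yE] [y' y'E] pE p'E hb hth.
have S0 : 0 < (`|s|%N)%:R :> R by rewrite ltr0n absz_gt0.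
have S'0 : 0 < (`|s'|%N)%:R :> R by rewrite ltr0n absz_gt0.
set S := (`|s|%N)%:R : R in yE S0; set S' := (`|s'|%N)%:R : R in y'E S'0.
have gap : 1 <= S * S' * (th' - th).
  have -> : S * S' * (th' - th) = (y' * (`|s|%N)%:Z - y * (`|s'|%N)%:Z)%:~R.
    by rewrite intrB !intrM -yE -y'E -!pmulrn -/S -/S'; ring.
  rewrite (_ : 1 = 1%:~R) // ler_int.
  have : 0 < (y' * (`|s|%N)%:Z - y * (`|s'|%N)%:Z)%:~R :> R.
    rewrite intrB !intrM -yE -y'E -!pmulrn -/S -/S'.
    have -> : S' * th' * S - S * th * S' = S * S' * (th' - th) by ring.
    by rewrite !mulr_gt0 // subr_gt0.
  by rewrite ltr0z.
have alphaS (r1 s1 : int) : s1 != 0 ->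
    `|qratio R r1 s1| * (`|s1|%N)%:R = (`|r1|%N)%:R.
  move=> s10; rewrite /qratio normf_div !pmulrn !abszE !intr_norm divfK //.
  by rewrite normr_eq0 intr_eq0.
have h1 := alphaS r s s0; have h2 := alphaS r' s' s'0.
rewrite -/S in h1; rewrite -/S' in h2.
have hbR : `|qratio R r s| * S * S' + `|qratio R r' s'| * S' * S < b%:R.
  by rewrite h1 h2 -!natrM -natrD ltr_nat.
have b0 : 0 <= b%:R :> R by [].
have := ler_wpM2l b0 gap; rewrite mulr1 => gapb.
have n1 := ler_norm (- qratio R r s); rewrite normrN in n1.
have n2 := ler_norm (qratio R r' s').
have SS : 0 < S * S' by rewrite mulr_gt0.
rewrite -(ltr_nat R) -subr_gt0 -(pmulr_rgt0 _ SS) pE p'E.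
have := ler_wpM2l (ltW SS) n1; have := ler_wpM2l (ltW SS) n2.
lra.
Qed.

(* If the fractional parts tie, then [qratio R r' s' - qratio R r s] is the
   integer [p - p'], so any positive multiplier [a] separates the two floors in
   the right order: the specific choice of [a] plays no role. *)
Lemma preceq_pos (a b : nat) (r s r' s' : int) (th th' : R) (p p' : nat) :
  (0 < a)%N -> s != 0 -> s' != 0 -> 0 < th <= 1 -> 0 < th' <= 1 ->
  (exists y : int, (`|s|%N)%:R * th = y%:~R) ->
  (exists y : int, (`|s'|%N)%:R * th' = y%:~R) ->
  p%:R = b%:R * th - qratio R r s -> p'%:R = b%:R * th' - qratio R r' s' ->
  (`|r| * `|s'| + `|r'| * `|s| < b)%N ->
  preceq (th - (Num.floor (1 - a%:R * qratio R r s))%:~R)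
         (th' - (Num.floor (1 - a%:R * qratio R r' s'))%:~R) = (p <= p')%N.
Proof.
move=> a0 s0 s'0 hth hth' y y' pE p'E hb.
rewrite /preceq -!mulrNz !frac1_unique //.
case: (ltgtP th th') => [lt|gt|eq] /=.
- by apply/esym/ltnW; apply: (@theta_gap b r s r' s' th th').
- apply/esym/negbTE; rewrite -ltnNge.
  by apply: (@theta_gap b r' s' r s th' th); rewrite // addnC.
have al : qratio R r' s' = qratio R r s + (p%:Z - p'%:Z)%:~R.
  by rewrite intrB -!pmulrn pE p'E eq; ring.
rewrite eq lerD2l ler_int lerN2 al.
have -> : 1 - a%:R * (qratio R r s + (p%:Z - p'%:Z)%:~R) =
   1 - a%:R * qratio R r s + (a%:Z * (p'%:Z - p%:Z))%:~R.
  by rewrite intrM !intrB -!pmulrn; ring.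
rewrite [X in (_ <= X)%R]floorDrz ?intr_int // intrKfloor lerDl pmulr_rge0 ?ltz_nat //.
by rewrite subr_ge0 lez_nat.
Qed.

Lemma preceq_trans (x y z : R) : preceq x y -> preceq y z -> preceq x z.
Proof.
rewrite /preceq => /orP[h1|/andP[/eqP h1 h1']] /orP[h2|/andP[/eqP h2 h2']].
- by rewrite (lt_trans h1 h2).
- by rewrite -h2 h1.
- by rewrite h1 h2.
- by rewrite h1 h2 eqxx (le_trans h2' h1') orbT.
Qed.

Section DownSets.
Variables (T : finType) (A : pred T) (val : T -> R) (pos : T -> nat).
Hypothesis val_pos : forall P Q, A P -> A Q ->
  preceq (val P) (val Q) = (pos P <= pos Q)%N.

(** The elements preceding [x] are closed downwards for [pos]; [n] is one more than their largest
    position, or 0 if there are none. *)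
Lemma preceq_initial (b : nat) (x : R) : (forall P, A P -> pos P < b)%N ->
  exists2 n, (n <= b)%N & forall P, A P -> preceq (val P) x = (pos P < n)%N.
Proof.
move=> posb; have [[P0 /andP[AP0 xP0]]|no] := pselect (exists P, A P && preceq (val P) x).
  have h0 : A P0 && preceq (val P0) x by rewrite AP0.
  case: (@arg_maxnP T P0 (fun P => A P && preceq (val P) x) pos h0) =>
    P1 /andP[AP1 xP1] mx.
  exists (pos P1).+1; first exact: posb.
  move=> P AP; rewrite ltnS; apply/idP/idP => h; first by apply: mx; rewrite AP.
  by apply: preceq_trans xP1; rewrite val_pos.
exists 0%N => // P AP; rewrite ltn0; apply/negbTE/negP => h.
by apply: no; exists P; rewrite AP.
Qed.

(** The threshold is the value at the largest position below [n]; the case without any such position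
    is kept apart. *)
Lemma initial_preceq (n : nat) :
  (forall P, A P -> ~~ (pos P < n)%N) \/
  exists x, forall P, A P -> preceq (val P) x = (pos P < n)%N.
Proof.
have [[P0 h0]|no] := pselect (exists P, A P && (pos P < n)%N).
  right; case: (@arg_maxnP T P0 (fun P => A P && (pos P < n)%N) pos h0) =>
    P1 /andP[AP1 xP1] mx.
  exists (val P1) => P AP; rewrite val_pos //; apply/idP/idP => h.
    exact: leq_ltn_trans xP1.
  by apply: mx; rewrite AP.
by left=> P AP; apply/negP => h; apply: no; exists P; rewrite AP.
Qed.
End DownSets.
End Order.

(** * Positions of a whole family *)

Definition theta (R : realType) (v : nat) (r s : 'I_v -> int) (e : 'I_v -> nat)
    (b : nat) (p : {i : 'I_v & 'I_(cgcd (r i) (s i) b)}) : R :=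
  (frac1 ((e (tag p))%:R * qratio R (r (tag p)) (s (tag p))) +
     (tagged p : nat)%:R) / (cgcd (r (tag p)) (s (tag p)) b)%:R.

(** The class of [k0] modulo b / c has c members below b, namely k0 + m (b / c) for m < c. So the
    pairs (i, m) counted by Xi match the zeros with k < b, and m shifts theta by m / c. *)
Lemma family_positions (R : realType) (v : nat) (r s : 'I_v -> int)
    (e : 'I_v -> nat) (b0 b : nat) :
  (forall i, s i != 0) -> (forall i, ~~ nonpos_int (qratio R (r i) (s i))) ->
  (forall i, b = b0 %[mod `|s i|])%N -> (forall i, `|r i| < b)%N ->
  (forall i, in_V (r i) (s i) b0 ->
     (b0 * e i = cgcd (r i) (s i) b0 %[mod `|s i|])%N) ->
  exists pos : {i : 'I_v & 'I_(cgcd (r i) (s i) b0)} -> nat,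
  (forall p, in_V (r (tag p)) (s (tag p)) b0 ->
    let th := theta R v r s e b0 p in
    [/\ (pos p < b)%N, 0 < th <= 1,
      exists y : int, (`|s (tag p)|%N)%:R * th = y%:~R
    & (pos p)%:R = b%:R * th - qratio R (r (tag p)) (s (tag p))]) /\
  (forall n, (n <= b)%N ->
    #|[set p | in_V (r (tag p)) (s (tag p)) b0 & (pos p < n)%N]| =
    \sum_(i < v) hits b (r i) (s i) n)%N.
Proof.
move=> s0 al bb rb he.
have /fin_all_exists[k0 hk0] : forall i, exists k0 : nat, in_V (r i) (s i) b0 ->
    let c := cgcd (r i) (s i) b0 in
    let F := frac1 ((e i)%:R * qratio R (r i) (s i)) in
    [/\ (k0 < b %/ c)%N, (c %| b)%N,
      k0%:R = (b %/ c)%:R * F - qratio R (r i) (s i),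
      exists y : int, (`|s i|%N)%:R / c%:R * F = y%:~R
    & forall k : nat, (b %| `|(r i + s i * k%:Z)%R|)%N = (k == k0 %[mod b %/ c])].
  (* Outside V_b the claim is vacuous and 0 is a default. *)
  move=> i; have [inV|_] := boolP (in_V (r i) (s i) b0); last by exists 0%N.
  have [k0 hk] := progression R (r i) (s i) b0 b (e i) (s0 i) (bb i) (rb i) (al i)
    inV (he i inV).
  by exists k0.
exists (fun p : {i : 'I_v & 'I_(cgcd (r i) (s i) b0)} =>
  k0 (tag p) + (tagged p : nat) * (b %/ cgcd (r (tag p)) (s (tag p)) b0))%N.
split=> [[i m] /= inV|n nb].
  have [k0g cb k0E [y yE] _] := hk0 i inV.
  rewrite /theta /=; move: m => /=.
  set c := cgcd (r i) (s i) b0 in k0g cb k0E yE *; set F := frac1 _ in k0E yE * => m.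
  set g := (b %/ c)%N in k0g k0E *.
  have c0 : (0 < c)%N by rewrite /c /cgcd !gcdn_gt0 (absz_gt0 (s i)) s0 orbT.
  have cR : 0 < c%:R :> R by rewrite ltr0n.
  have bE : b = (g * c)%N by rewrite divnK.
  have mc : (m.+1%:R <= c%:R :> R) by rewrite ler_nat.
  have FB := frac1_bounds R ((e i)%:R * qratio R (r i) (s i)).
  rewrite -/F in FB.
  have cs : (c %| `|s i|)%N.
    exact: dvdn_trans (dvdn_gcdl _ _) (dvdn_gcdr _ _).
  have [s' sE] := dvdnP cs.
  have cR0 := lt0r_neq0 cR.
  split.
  - rewrite bE; apply: (@leq_trans (m.+1 * g)); first by rewrite mulSn ltn_add2r.
    by rewrite mulnC leq_mul2l ltn_ord orbT.
  - rewrite divr_gt0 //=; last by rewrite ltr_pwDl // ?ler0n; lra.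
    rewrite ler_pdivrMr // mul1r (le_trans _ mc) // -natr1; lra.
  - exists (y + (s' * m)%N%:Z).
    rewrite intrD -yE -pmulrn sE !natrM; field.
    by rewrite cR0.
  - by rewrite natrD natrM k0E bE natrM; field; rewrite cR0.
transitivity (\sum_(i < v) \sum_(m < cgcd (r i) (s i) b0 |
     in_V (r i) (s i) b0 && (k0 i + m * (b %/ cgcd (r i) (s i) b0) < n)%N) 1)%N.
  by rewrite -sum1dep_card sig_big_dep.
apply: eq_bigr => i _.
have [inV|inV] := boolP (in_V (r i) (s i) b0); last first.
  by rewrite big_pred0_eq hits_in_V // (in_V_mod _ _ _ _ (bb i)).
have [k0g cb _ _ hk] := hk0 i inV.
rewrite /= big_mkcond (eq_bigr (fun m : 'I__ =>
   (k0 i + m * (b %/ cgcd (r i) (s i) b0) < n)%N : nat)); last by move=> m _; case: ifP.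
rewrite count_progression ?divnK //.
by apply: eq_bigr => k _; rewrite hk.
Qed.

Definition coef_bound (v w : nat) (r s : 'I_v -> int) (t u : 'I_w -> int) : nat :=
  (\sum_(i < v) (`|r i| + `|s i|) + \sum_(j < w) (`|t j| + `|u j|))%N.

Section Positions.
Variables (R : realType) (v w : nat).
Variables (r s : 'I_v -> int) (t u : 'I_w -> int).
Variables (e : 'I_v -> nat) (f : 'I_w -> nat).
Hypothesis s_neq0 : forall i, s i != 0.
Hypothesis u_neq0 : forall j, u j != 0.
Hypothesis alphaN : forall i, ~~ nonpos_int (qratio R (r i) (s i)).
Hypothesis betaN : forall j, ~~ nonpos_int (qratio R (t j) (u j)).

Let M := coef_bound v w r s t u.

Lemma drt_gt0 : (0 < drt s u)%N.
Proof.
rewrite /drt lcmn_gt0; apply/andP; split.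
  by elim/big_ind: _ => // [x y x0 y0|i _]; rewrite ?lcmn_gt0 ?x0 ?y0 ?absz_gt0.
by elim/big_ind: _ => // [x y x0 y0|i _]; rewrite ?lcmn_gt0 ?x0 ?y0 ?absz_gt0.
Qed.

Lemma dvdn_drtl i : (`|s i| %| drt s u)%N.
Proof. by apply: dvdn_trans (dvdn_lcml _ _); rewrite (bigD1 i) //= dvdn_lcml. Qed.

Lemma dvdn_drtr j : (`|u j| %| drt s u)%N.
Proof. by apply: dvdn_trans (dvdn_lcmr _ _); rewrite (bigD1 j) //= dvdn_lcml. Qed.

(** Thresholds x in Xi correspond to truncations n <= b, and larger n follow by periodicity. In the
    bound on [b], the term 2 M^2 serves [theta_gap] and M serves |r| < b. *)
Lemma Xi_ge0_hits (b0 b : nat) :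
  b = b0 %[mod drt s u] -> (2 * M ^ 2 + M < b)%N ->
  (forall i, in_V (r i) (s i) b0 ->
     (b0 * e i = cgcd (r i) (s i) b0 %[mod `|s i|])%N) ->
  (forall j, in_V (t j) (u j) b0 ->
     (b0 * f j = cgcd (t j) (u j) b0 %[mod `|u j|])%N) ->
  (forall n, \sum_(j < w) hits b (t j) (u j) n <=
             \sum_(i < v) hits b (r i) (s i) n)%N <->
  (forall x : R, 0 <= Xi r s t u e f b0 x).
Proof.
move=> bb hb he hf.
have modd (m : nat) : (m %| drt s u)%N -> (b = b0 %[mod m])%N.
  by move=> md; rewrite -(modn_dvdm b md) bb modn_dvdm.
have rM i : (`|r i| <= M)%N by rewrite /M /coef_bound (bigD1 i) //=; lia.
have sM i : (`|s i| <= M)%N by rewrite /M /coef_bound (bigD1 i) //=; lia.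
have tM j : (`|t j| <= M)%N by rewrite /M /coef_bound addnC (bigD1 j) //=; lia.
have uM j : (`|u j| <= M)%N by rewrite /M /coef_bound addnC (bigD1 j) //=; lia.
have Mb : (M < b)%N by apply: leq_ltn_trans hb; exact: leq_addl.
have hbb (x1 x2 y1 y2 : nat) : (x1 <= M -> x2 <= M -> y1 <= M -> y2 <= M ->
    x1 * x2 + y1 * y2 < b)%N.
  move=> *; apply: leq_ltn_trans hb; apply: leq_trans (leq_addr _ _).
  by rewrite mul2n -addnn leq_add // -mulnn leq_mul.
have [pos1 [P1 C1]] := family_positions R v r s e b0 b s_neq0 alphaN
  (fun i => modd _ (dvdn_drtl i)) (fun i => leq_ltn_trans (rM i) Mb) he.
have [pos2 [P2 C2]] := family_positions R w t u f b0 b u_neq0 betaN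
  (fun i => modd _ (dvdn_drtr i)) (fun i => leq_ltn_trans (tM i) Mb) hf.
have [/andP[a0 _] _] := ainvP b0 drt_gt0.
set a := ainv (drt s u) b0 in a0.
pose shift (th : R) (r1 s1 : int) : R :=
  th - (Num.floor (1 - a%:R * qratio R r1 s1))%:~R.
pose val1 p := shift (theta R v r s e b0 p) (r (tag p)) (s (tag p)).
pose val2 p := shift (theta R w t u f b0 p) (t (tag p)) (u (tag p)).
pose A1 p := in_V (r (tag p : 'I_v)) (s (tag p)) b0.
pose A2 p := in_V (t (tag p : 'I_w)) (u (tag p)) b0.
(* Numerator and denominator pairs are merged, so that one order comparison also covers mixed
   pairs. *)
pose T : finType := ({i : 'I_v & 'I_(cgcd (r i) (s i) b0)} +
   {j : 'I_w & 'I_(cgcd (t j) (u j) b0)})%type.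
pose A (p : T) := match p with inl p => A1 _ p | inr p => A2 _ p end.
pose val (p : T) := match p with inl p => val1 p | inr p => val2 p end.
pose pos (p : T) := match p with inl p => pos1 p | inr p => pos2 p end.
have val_pos (P Q : T) : A P -> A Q -> preceq (val P) (val Q) = (pos P <= pos Q)%N.
  case: P => P; case: Q => Q /= hP hQ; apply: (@preceq_pos _ _ b);
    by [|apply: hbb| case: (P1 _ hP) | case: (P1 _ hQ) | case: (P2 _ hP) | case: (P2 _ hQ)].
have posb (P : T) : A P -> (pos P < b)%N.
  by case: P => P /= hP; [case: (P1 _ hP)|case: (P2 _ hP)].
have XiE x : 0 <= Xi r s t u e f b0 x =
   (#|[set p | A2 _ p & preceq (val2 p) x]| <= #|[set p | A1 _ p & preceq (val1 p) x]|)%N.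
  by rewrite /Xi subr_ge0 lez_nat.
have counts x n : (n <= b)%N ->
    (forall P, A P -> preceq (val P) x = (pos P < n)%N) ->
    (0 <= Xi r s t u e f b0 x) = (\sum_(j < w) hits b (t j) (u j) n <=
             \sum_(i < v) hits b (r i) (s i) n)%N.
  move=> nb h; rewrite XiE -C1 // -C2 //.
  congr (_ <= _)%N; apply: eq_card => p; rewrite !inE; apply: andb_id2l => hp.
    exact: (h (inr p)).
  exact: (h (inl p)).
split=> [H x|H n].
  by have [n nb hn] := preceq_initial _ _ A val pos val_pos _ x posb; rewrite (counts x n).
have small m : (m <= b)%N -> (\sum_(j < w) hits b (t j) (u j) m <=
             \sum_(i < v) hits b (r i) (s i) m)%N.
  move=> mb; have [no|[x hx]] := initial_preceq _ _ A val pos val_pos m.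
    (* No position lies below [m], so the denominator count is zero. *)
    rewrite -C1 // -C2 // (_ : [set p | _ & _] = set0) ?cards0 //.
    apply/setP => p; rewrite !inE; apply/negbTE/negP => /andP[hp].
    by apply/negP; apply: (no (inr p)).
  by rewrite -(counts x).
have b0' : (0 < b)%N by apply: leq_ltn_trans Mb.
(* Each full block of length [b] adds the inequality at [b] itself. *)
rewrite (divn_eq n b); elim: (n %/ b)%N => [|k IH].
  by rewrite mul0n; apply: small; rewrite ltnW // ltn_pmod.
have -> : (k.+1 * b + n %% b = (k * b + n %% b) + b)%N by rewrite mulSn; lia.
under eq_bigr do rewrite hits_period.
under [X in (_ <= X)%N]eq_bigr do rewrite hits_period.
by rewrite !big_split leq_add // small.
Qed.
End Positions.

(** * The equivalence, from large b to residues modulo d *)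

Local Open Scope complex_scope.

Theorem theorem1p3 (R : realType) (q : R[i])
    (hq : ~ algebraicOver (ratr : rat -> R[i]) q)
    (v w : nat) (hv : (0 < v)%N) (hw : (0 < w)%N)
    (r s : 'I_v -> int) (t u : 'I_w -> int)
    (hs : forall i, 0 < s i) (hu : forall j, u j != 0)
    (halpha : forall i, ~~ nonpos_int (qratio R (r i) (s i)))
    (hbeta : forall j, ~~ nonpos_int (qratio R (t j) (u j)))
    (e : nat -> 'I_v -> nat) (f : nat -> 'I_w -> nat)
    (he : valid_choice r s (drt s u) e) (hf : valid_choice t u (drt s u) f) :
  q_integral q (Qrt q r s t u) <->
  (forall (b : nat) (x : R), (1 <= b <= drt s u)%N ->
     0 <= Xi r s t u (e b) (f b) b x).
Proof.
have zeval_eq0 P : zeval q P = 0 -> P = 0.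
  move=> Pq; apply/eqP; apply: contrapT => /negP P0; apply: hq.
  exists (map_poly intr P).
    by rewrite map_poly_eq0_id0 // intr_eq0 lead_coef_eq0.
  rewrite /root -map_poly_comp (eq_map_poly (g := intr)) => [|z]; last exact: ratr_int.
  exact/eqP.
have s0 i : s i != 0 by rewrite gt_eqF.
have num0 i k : r i + s i * Posz k != 0 by apply: (qratio_pole R).
have den0 j k : t j + u j * Posz k != 0 by apply: (qratio_pole R).
have d0 := drt_gt0 v w s u s0 hu.
set d := drt s u in d0 *.
pose M := coef_bound v w r s t u.
split=> [/(hits_le_of_q_integral _ _ zeval_eq0 _ _ _ _ _ _ num0 den0)[B hB] b0 x b0d|H].
  (* A representative of the class of [b0] beyond both thresholds. *)
  pose b := (b0 + (B + (2 * M ^ 2 + M).+1) * d)%N.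
  have bd : b = b0 %[mod d] by rewrite /b addnC modnMDl.
  have bb : (B + (2 * M ^ 2 + M).+1 <= b)%N.
    by rewrite /b (leq_trans _ (leq_addl _ _)) // leq_pmulr.
  apply: (Xi_ge0_hits R v w r s t u (e b0) (f b0) s0 hu halpha hbeta b0 b bd _ _ _).1.
  - by apply: leq_trans bb; exact: leq_addl.
  - by move=> i inV; have [] := he b0 i b0d inV.
  - by move=> j inV; have [] := hf b0 j b0d inV.
  by move=> n; apply: hB; apply: leq_trans bb; exact: leq_addr.
apply: (q_integral_of_hits_le _ _ zeval_eq0 _ _ _ _ _ _ hs num0 den0 (2 * M ^ 2 + M).+1).
move=> b n Mb.
(* Residues are taken in {1, ..., d}: the class of 0 is represented by [d]. *)
pose b0 := (if b %% d == 0 then d else b %% d)%N.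
have b0d : (1 <= b0 <= d)%N.
  rewrite /b0; case: eqP => [_|/eqP h]; first by rewrite d0 leqnn.
  by rewrite lt0n h ltnW // ltn_pmod.
have bd : b = b0 %[mod d].
  by rewrite /b0; case: eqP => [->|_]; rewrite ?modnn ?modn_mod.
apply: (Xi_ge0_hits R v w r s t u (e b0) (f b0) s0 hu halpha hbeta b0 b bd Mb _ _).2.
- by move=> i inV; have [] := he b0 i b0d inV.
- by move=> j inV; have [] := hf b0 j b0d inV.
by move=> x; apply: H.
Qed.
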